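(* Let $(M,\phi,\xi,\eta,g)$ be a $(2n+1)$-dimensional para-Sasaki-like Riemannian manifold. Then: (a) the manifold is a normal paracontact Riemannian manifold, i.e. $N=0$ and $2\widetilde g|_H=(\mathcal L_\xi g)|_H$; the 1-form $\eta$ is closed, $d\eta=0$; and the integral curves of $\xi$ are geodesics, $\nabla_\xi\xi=0$; (b) the 1-forms $\theta$ and $\theta^*$ satisfy $\theta=-2n\,\eta$ and $\theta^*=0$.
   Context: An almost paracontact paracomplex Riemannian manifold $(M,\phi,\xi,\eta,g)$ is a smooth manifold of dimension $2n+1$ with a $(1,1)$-tensor field $\phi$, a vector field $\xi$, a 1-form $\eta$ satisfying $\phi^2=\mathrm{id}-\eta\otimes\xi$, $\eta(\xi)=1$ (consequently $\phi\xi=0$, $\eta\circ\phi=0$), such that on $H=\ker\eta$ the eigenvalues $+1$ and $-1$ of $\phi|_H$ both have multiplicity $n$ (so $\mathrm{tr}\,\phi=0$), and a Riemannian metric $g$ with $g(x,\xi)=\eta(x)$ and $g(\phi x,\phi y)=g(x,y)-\eta(x)\eta(y)$. Let $\nabla$ be the Levi-Civita connection of $g$. Put $F(x,y,z)=g((\nabla_x\phi)y,z)$. The manifold is called para-Sasaki-like if for all horizontal $X,Y,Z\in H$: $F(X,Y,Z)=F(\xi,Y,Z)=F(\xi,\xi,Z)=0$ and $F(X,Y,\xi)=-g(X,Y)$. The associated metric is $\widetilde g(x,y)=g(x,\phi y)+\eta(x)\eta(y)$. The structure is paracontact if $2g(x,\phi y)=(\mathcal L_\xi g)(x,y)=(\nabla_x\eta)(y)+(\nabla_y\eta)(x)$,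 and normal if $N=0$, where $N=[\phi,\phi]-d\eta\otimes\xi$ with $[\phi,\phi](x,y)=[\phi x,\phi y]+\phi^2[x,y]-\phi[\phi x,y]-\phi[x,\phi y]$ and $d\eta(x,y)=(\nabla_x\eta)(y)-(\nabla_y\eta)(x)$. The 1-forms are $\theta(z)=\sum_{i=1}^{2n}F(e_i,e_i,z)$ and $\theta^*(z)=\sum_{i=1}^{2n}F(e_i,\phi e_i,z)$, where $\{e_1,\dots,e_{2n}\}$ is an orthonormal basis of $H$. *)

(* Defs.v *)
From HB Require Import structures.
From mathcomp Require Import all_boot all_order all_algebra.
From mathcomp Require Import all_classical all_reals all_analysis.
From mathcomp Require Import ring.

Set Implicit Arguments.
Unset Strict Implicit.
Unset Printing Implicit Defensive.

Import Order.TTheory GRing.Theory Num.Theory.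
Import numFieldNormedType.Exports.

Local Open Scope classical_set_scope.
Local Open Scope ring_scope.

Section SmoothOn.
Context {R : realType} {V W : normedModType R}.
Implicit Types (U : set V) (f g : V -> W).

(* All iterated directional derivatives of order at most k exist and are
   continuous on U; only meant for open U. *)
Fixpoint Ck_on (k : nat) U f : Prop :=
  (forall x, U x -> {for x, continuous f}) /\
  (if k is k'.+1 then
     forall v, (forall x, U x -> derivable f x v) /\ Ck_on k' U ('D_v f)
   else True).

Definition smooth_on U f : Prop := forall k, Ck_on k U f.

Lemma Ck_on_cont k U f :
  Ck_on k U f -> forall x, U x -> {for x, continuous f}.
Proof. by case: k => [|k] []. Qed.

Lemma Ck_on_ext k U f g : open U -> (forall x, U x -> f x = g x) ->
  Ck_on k U f -> Ck_on k U g.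
Proof.
have near_fg f' g' x : open U -> (forall x, U x -> f' x = g' x) -> U x ->
    {near x, f' =1 g'}.
  by move=> oU fg Ux; near=> y; apply: fg; near: y; exact: open_nbhs_nbhs.
have contE f' g' x : open U -> (forall x, U x -> f' x = g' x) -> U x ->
    {for x, continuous f'} -> {for x, continuous g'}.
  move=> oU fg Ux cf; rewrite /prop_for /continuous_at -(fg _ Ux).
  by apply: cvg_trans cf; apply: near_eq_cvg; exact: near_fg.
move=> oU; elim: k f g => [|k IH] f g fg /= [cf df]; split=> //.
- by move=> x Ux; exact: contE (cf x Ux).
- by move=> x Ux; exact: contE (cf x Ux).
- move=> v; have [dfv cfv] := df v; split=> [x Ux|].
    exact: near_eq_derivable (near_fg _ _ _ oU fg Ux) (dfv _ Ux).
  apply: IH cfv => x Ux; apply: near_eq_derive; exact: near_fg.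
Unshelve. all: by end_near. Qed.

Lemma Ck_on_cst k U (w : W) : Ck_on k U (cst w).
Proof.
elim: k w => [|k IH] w /=; split=> //.
- by move=> x _; exact: cst_continuous.
- by move=> x _; exact: cst_continuous.
- move=> v; split=> [x _|]; first exact: derivable_cst.
  suff -> : 'D_v (cst w) = cst (0 : W) by exact: IH.
  by apply/funext => x; rewrite derive_cst.
Qed.

Lemma Ck_on_lin k U (a : R) f g : open U ->
  Ck_on k U f -> Ck_on k U g -> Ck_on k U (a *: f + g).
Proof.
move=> oU; elim: k f g => [|k IH] f g /= [cf df] [cg dg]; split=> //.
- by move=> x Ux; apply: cvgD; [apply: cvgZr; exact: cf|exact: cg].
- by move=> x Ux; apply: cvgD; [apply: cvgZr; exact: cf|exact: cg].
- move=> v; have [dfv cfv] := df v; have [dgv cgv] := dg v; split=> [x Ux|].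
    by apply: derivableD; [apply: derivableZ; exact: dfv|exact: dgv].
  apply: Ck_on_ext (IH _ _ cfv cgv) => // x Ux.
  rewrite deriveD; [|by apply: derivableZ; exact: dfv|exact: dgv].
  by rewrite deriveZ //; exact: dfv.
Qed.

End SmoothOn.

Lemma Ck_on_pred {R : realType} {V W : normedModType R} k (U : set V)
  (f : V -> W) : Ck_on k.+1 U f -> Ck_on k U f.
Proof.
elim: k f => [|k IH] f [cf df]; split=> // v.
by have [dfv cfv] := df v; split=> //; exact: IH.
Qed.

Lemma Ck_on_mul {R : realType} {V : normedModType R} k (U : set V)
  (f g : V -> R) : open U -> Ck_on k U f -> Ck_on k U g -> Ck_on k U (f * g).
Proof.
move=> oU; elim: k f g => [|k IH] f g Cf Cg.
  case: Cf => cf _; case: Cg => cg _.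
  by split=> // x Ux; apply: cvgM; [exact: cf|exact: cg].
have Cf' := Ck_on_pred Cf; have Cg' := Ck_on_pred Cg.
move: Cf Cg => [cf df] [cg dg]; split.
  by move=> x Ux; apply: cvgM; [exact: cf|exact: cg].
move=> v; have [dfv cfv] := df v; have [dgv cgv] := dg v; split=> [x Ux|].
  by apply: derivableM; [exact: dfv|exact: dgv].
have := Ck_on_lin 1 oU (IH _ _ Cf' cgv) (IH _ _ Cg' cfv).
apply: Ck_on_ext => // x Ux.
rewrite deriveM; [|exact: dfv|exact: dgv].
by rewrite scale1r.
Qed.

Record chart (R : realType) (m : nat) (M : topologicalType) := Chart {
  cdom : set M;
  cimg : set 'rV[R]_m;
  cmap : M -> 'rV[R]_m;
  cinv : 'rV[R]_m -> M;
  cdom_open : open cdom;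
  cimg_open : open cimg;
  cmapP : forall p, cdom p -> cimg (cmap p) /\ cinv (cmap p) = p;
  cinvP : forall y, cimg y -> cdom (cinv y) /\ cmap (cinv y) = y;
  cmap_cont : forall p, cdom p -> {for p, continuous cmap};
  cinv_cont : forall y, cimg y -> {for y, continuous cinv};
}.

Arguments cdom_open {R m M} c.
Arguments cimg_open {R m M} c.

(* The atlas need not be maximal: it determines the smooth structure. *)
Record manifold (R : realType) (m : nat) := Manifold {
  mcarrier :> topologicalType;
  atlas : set (chart R m mcarrier);
  mhausdorff : hausdorff_space mcarrier;
  msecond_countable : @second_countable mcarrier;
  atlas_cover : forall p, exists2 c, atlas c & cdom c p;
  atlas_compat : forall c d, atlas c -> atlas d ->
    smooth_on (cimg c `&` cinv c @^-1` cdom d) (cmap d \o cinv c);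
}.

Section Functions.
Context {R : realType} {m : nat}.
Variable M : manifold R m.

Definition smooth : {pred M -> R} := fun f =>
  `[< forall c : chart R m M, atlas c -> smooth_on (cimg c) (f \o cinv c) >].

Record smooth_fun := SmoothFun {
  sfun_val :> M -> R;
  sfun_smooth : sfun_val \in smooth
}.

HB.instance Definition _ := [isSub for sfun_val].
HB.instance Definition _ := [Choice of smooth_fun by <:].

Lemma smooth_cst (a : R) : cst a \in smooth.
Proof. by apply/asboolP => c _ k; exact: Ck_on_cst. Qed.

Lemma smooth_lin (a : R) (f g : M -> R) :
  f \in smooth -> g \in smooth -> a *: f + g \in smooth.
Proof.
move=> /asboolP sf /asboolP sg; apply/asboolP => c ac k.
exact: Ck_on_lin (cimg_open c) (sf c ac k) (sg c ac k).
Qed.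

Lemma smooth_subring_closed : subring_closed smooth.
Proof.
split=> [|f g sf sg|f g /asboolP sf /asboolP sg].
- exact: smooth_cst.
- by have := smooth_lin (-1) sg sf; rewrite scaleN1r addrC.
- apply/asboolP => c ac k.
  exact: Ck_on_mul (cimg_open c) (sf c ac k) (sg c ac k).
Qed.

HB.instance Definition _ :=
  GRing.isSubringClosed.Build _ smooth smooth_subring_closed.
HB.instance Definition _ :=
  GRing.SubChoice_isSubComPzRing.Build _ smooth smooth_fun smooth_subring_closed.

Lemma smooth_scaler_closed : GRing.scaler_closed smooth.
Proof.
by move=> a f sf; rewrite -[a *: f]addr0; apply: smooth_lin => //; exact: rpred0.
Qed.

HB.instance Definition _ :=
  GRing.isScaleClosed.Build R _ smooth smooth_scaler_closed.
HB.instance Definition _ := [SubZmodule_isSubLmodule of smooth_fun by <:].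


End Functions.

Arguments smooth {R m M}.

Section Tangent.
Context {R : realType} {m : nat} {M : manifold R m}.

(* Tangent vectors at p are the derivations at p of the algebra of smooth
   functions. *)
Definition derivation_at (p : M) : {pred smooth_fun M -> R} := fun v =>
  `[< (forall (a : R) f h, v (a *: f + h) = a * v f + v h) /\
      (forall f h, v (f * h) = f p * v h + h p * v f) >].

Record tangent (p : M) := Tangent {
  tan_val :> smooth_fun M -> R;
  tan_derivation : tan_val \in derivation_at p
}.

HB.instance Definition _ (p : M) := [isSub for @tan_val p].
HB.instance Definition _ (p : M) := [Choice of tangent p by <:].

Lemma derivation_at_submod_closed (p : M) : submod_closed (derivation_at p).
Proof.
split=> [|a u v /asboolP[lu du] /asboolP[lv dv]]; apply/asboolP; split.
- by move=> a f h; rewrite mulr0 addr0.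
- by move=> f h; rewrite !mulr0 addr0.
- move=> b f h; rewrite /= !fctE lu lv /GRing.scale /=; ring.
- move=> f h; rewrite /= !fctE du dv /GRing.scale /=; ring.
Qed.

HB.instance Definition _ (p : M) :=
  GRing.isSubmodClosed.Build R _ (derivation_at p)
    (derivation_at_submod_closed p).
HB.instance Definition _ (p : M) :=
  [SubChoice_isSubLmodule of tangent p by <:].

Definition smooth_field (X : forall p : M, tangent p) : Prop :=
  forall f : smooth_fun M, (fun p => X p f) \in smooth.

Record vfield := VField {
  vf_at :> forall p : M, tangent p;
  vf_smooth : smooth_field vf_at
}.


Lemma smooth_funP (f h : smooth_fun M) : (forall p, f p = h p) -> f = h.
Proof. by move=> fh; apply/val_inj/funext. Qed.

Lemma tangentP (p : M) (u v : tangent p) : (forall f, u f = v f) -> u = v.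
Proof. by move=> uv; apply/val_inj/funext. Qed.

Lemma tangent_lin (p : M) (v : tangent p) (a : R) f h :
  v (a *: f + h) = a * v f + v h.
Proof. by have /asboolP[] := tan_derivation v. Qed.

Lemma tangent_mul (p : M) (v : tangent p) f h :
  v (f * h) = f p * v h + h p * v f.
Proof. by have /asboolP[] := tan_derivation v. Qed.

Lemma vfieldP (X Y : vfield) : (forall p, X p = Y p) -> X = Y.
Proof.
case: X Y => [X sX] [Y sY] /= XY.
have {}XY : X = Y by exact/functional_extensionality_dep.
by case: Y / XY sY => sY; congr VField; exact: Prop_irrelevance.
Qed.

Definition vf_dir (X : vfield) (f : smooth_fun M) : smooth_fun M :=
  SmoothFun (vf_smooth X f).

HB.instance Definition _ := gen_eqMixin vfield.
HB.instance Definition _ := gen_choiceMixin vfield.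

Lemma vf_zero_subproof : smooth_field (fun p : M => 0).
Proof. by move=> f; exact: smooth_cst. Qed.

Lemma vf_opp_subproof (X : vfield) : smooth_field (fun p : M => - X p).
Proof. by move=> f; exact: sfun_smooth (- vf_dir X f). Qed.

Lemma vf_add_subproof (X Y : vfield) : smooth_field (fun p : M => X p + Y p).
Proof. by move=> f; exact: sfun_smooth (vf_dir X f + vf_dir Y f). Qed.

Lemma vf_scale_subproof (h : smooth_fun M) (X : vfield) :
  smooth_field (fun p : M => h p *: X p).
Proof. by move=> f; exact: sfun_smooth (h * vf_dir X f). Qed.

Let vf_zero := VField vf_zero_subproof.
Let vf_opp X := VField (vf_opp_subproof X).
Let vf_add X Y := VField (vf_add_subproof X Y).
Let vf_scale h X := VField (vf_scale_subproof h X).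

Let vf_addA : associative vf_add.
Proof. by move=> X Y Z; apply: vfieldP => p; exact: addrA. Qed.
Let vf_addC : commutative vf_add.
Proof. by move=> X Y; apply: vfieldP => p; exact: addrC. Qed.
Let vf_add0 : left_id vf_zero vf_add.
Proof. by move=> X; apply: vfieldP => p; exact: add0r. Qed.
Let vf_addN : left_inverse vf_zero vf_opp vf_add.
Proof. by move=> X; apply: vfieldP => p; exact: addNr. Qed.

HB.instance Definition _ :=
  GRing.isZmodule.Build vfield vf_addA vf_addC vf_add0 vf_addN.

Let vf_scaleA f h X : vf_scale f (vf_scale h X) = vf_scale (f * h) X.
Proof. by apply: vfieldP => p; exact: scalerA. Qed.
Let vf_scale1 : left_id 1 vf_scale.
Proof. by move=> X; apply: vfieldP => p; exact: scale1r. Qed.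
Let vf_scaleDr : right_distributive vf_scale +%R.
Proof. by move=> f X Y; apply: vfieldP => p; exact: scalerDr. Qed.
Let vf_scaleDl X : {morph vf_scale^~ X : f h / f + h}.
Proof. by move=> f h; apply: vfieldP => p; exact: scalerDl. Qed.

HB.instance Definition _ := GRing.Zmodule_isLmodule.Build (smooth_fun M) vfield
  vf_scaleA vf_scale1 vf_scaleDr vf_scaleDl.

Section Bracket.
Variables X Y : vfield.

Lemma bracket_derivation (p : M) :
  (fun f => X p (vf_dir Y f) - Y p (vf_dir X f)) \in derivation_at p.
Proof.
have dlin (Z : vfield) a f h :
    vf_dir Z (a *: f + h) = a *: vf_dir Z f + vf_dir Z h.
  by apply: smooth_funP => q; exact: tangent_lin.
have dmul (Z : vfield) f h :
    vf_dir Z (f * h) = f * vf_dir Z h + h * vf_dir Z f.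
  by apply: smooth_funP => q; exact: tangent_mul.
have addE (Z : vfield) f h : Z p (f + h) = Z p f + Z p h.
  by have := tangent_lin (Z p) 1 f h; rewrite scale1r mul1r.
apply/asboolP; split=> [a f h|f h].
  by rewrite !dlin !tangent_lin; ring.
by rewrite !dmul !addE !tangent_mul /=; ring.
Qed.

Lemma bracket_smooth : smooth_field (fun p => Tangent (bracket_derivation p)).
Proof.
move=> f.
exact: sfun_smooth (vf_dir X (vf_dir Y f) - vf_dir Y (vf_dir X f)).
Qed.

Definition bracket : vfield := VField bracket_smooth.

End Bracket.

End Tangent.

Arguments vfield {R m} M.

Section Tensors.
Context {R : realType} {m : nat}.
Variable M : manifold R m.

(* Tensor fields are families of multilinear maps on the tangent spaces that
   send smooth vector fields to smooth vector fields or functions. *)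
Record endo_field := EndoField {
  endo_at : forall p : M, {linear tangent p -> tangent p};
  endo_smooth : forall X : vfield M, smooth_field (fun p => endo_at p (X p))
}.

Definition endo_app (A : endo_field) (X : vfield M) : vfield M :=
  VField (endo_smooth A X).

Record one_form := OneForm {
  form_at : forall p : M, {scalar tangent p};
  form_smooth : forall X : vfield M, (fun p => form_at p (X p)) \in smooth
}.

Definition form_app (w : one_form) (X : vfield M) : smooth_fun M :=
  SmoothFun (form_smooth w X).

Record riemannian_metric := RiemannianMetric {
  metric_at : forall p : M, {biscalar tangent p};
  metric_smooth : forall X Y : vfield M,
    (fun p => metric_at p (X p) (Y p)) \in smooth;
  metric_sym : forall (p : M) (x y : tangent p),
    metric_at p x y = metric_at p y x;
  metric_pos : forall (p : M) (x : tangent p), x != 0 -> 0 < metric_at p x x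
}.

Definition metric_app (g : riemannian_metric) (X Y : vfield M) : smooth_fun M :=
  SmoothFun (metric_smooth g X Y).

End Tensors.

Coercion endo_app : endo_field >-> Funclass.
Coercion form_app : one_form >-> Funclass.
Coercion metric_app : riemannian_metric >-> Funclass.

Section Connection.
Context {R : realType} {m : nat} {M : manifold R m}.

Record connection := Connection {
  nabla :> vfield M -> vfield M -> vfield M;
  nabla_tensorial : forall (f : smooth_fun M) (X X' Y : vfield M),
    nabla (f *: X + X') Y = f *: nabla X Y + nabla X' Y;
  nabla_additive : forall X Y Y' : vfield M,
    nabla X (Y + Y') = nabla X Y + nabla X Y';
  nabla_leibniz : forall (f : smooth_fun M) (X Y : vfield M),
    nabla X (f *: Y) = vf_dir X f *: Y + f *: nabla X Y
}.

Definition levi_civita (g : riemannian_metric M) (D : connection) : Prop :=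
  (forall X Y : vfield M, D X Y - D Y X = bracket X Y) /\
  (forall X Y Z : vfield M, vf_dir X (g Y Z) = g (D X Y) Z + g Y (D X Z)).

Definition cov_endo (D : connection) (A : endo_field M) (X Y : vfield M)
    : vfield M := D X (A Y) - A (D X Y).

Definition cov_form (D : connection) (w : one_form M) (X Y : vfield M)
    : smooth_fun M := vf_dir X (w Y) - w (D X Y).

(* For a torsion-free D this is the exterior derivative, normalised so that
   dw(X, Y) = X(w(Y)) - Y(w(X)) - w([X, Y]). *)
Definition ext_deriv (D : connection) (w : one_form M) (X Y : vfield M)
    : smooth_fun M := cov_form D w X Y - cov_form D w Y X.

Definition lie_metric (Z : vfield M) (g : riemannian_metric M) (X Y : vfield M)
    : smooth_fun M :=
  vf_dir Z (g X Y) - g (bracket Z X) Y - g X (bracket Z Y).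

Definition nijenhuis (A : endo_field M) (X Y : vfield M) : vfield M :=
  bracket (A X) (A Y) + A (A (bracket X Y))
  - A (bracket (A X) Y) - A (bracket X (A Y)).

End Connection.

Arguments connection {R m} M.

Definition is_basis {R : realType} {V : lmodType R} {k : nat}
    (E : set V) (b : 'I_k -> V) : Prop :=
  (forall i, E (b i)) /\
  (forall x, E x -> exists! c : {ffun 'I_k -> R}, x = \sum_i c i *: b i).

Definition has_dim {R : realType} {V : lmodType R} (E : set V) (k : nat) :=
  exists b : 'I_k -> V, is_basis E b.

(* Almost paracontact paracomplex Riemannian structures. On the horizontal
   spaces phi^2 = id, so the multiplicity of an eigenvalue is the dimension of
   its eigenspace. *)
Record almost_paracontact (R : realType) (n : nat) (M : manifold R (2 * n + 1)) :=
  AlmostParacontact {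
  phi : endo_field M;
  xi : vfield M;
  eta : one_form M;
  metric : riemannian_metric M;
  phi_sq : forall (p : M) (x : tangent p),
    endo_at phi p (endo_at phi p x) = x - form_at eta p x *: xi p;
  eta_xi : forall p : M, form_at eta p (xi p) = 1;
  phi_eigen1 : forall p : M, has_dim
    [set x : tangent p | form_at eta p x = 0 /\ endo_at phi p x = x] n;
  phi_eigenN1 : forall p : M, has_dim
    [set x : tangent p | form_at eta p x = 0 /\ endo_at phi p x = - x] n;
  metric_xi : forall (p : M) (x : tangent p),
    metric_at metric p x (xi p) = form_at eta p x;
  metric_phi : forall (p : M) (x y : tangent p),
    metric_at metric p (endo_at phi p x) (endo_at phi p y) =
    metric_at metric p x y - form_at eta p x * form_at eta p y
}.

Section AlmostParacontact.
Context {R : realType} {n : nat} {M : manifold R (2 * n + 1)}.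
Variables (S : almost_paracontact M) (D : connection M).

Definition horizontal (X : vfield M) : Prop := eta S X = 0.

(* F(X, Y, Z) = g((D_X phi) Y, Z). *)
Definition fundF (X Y Z : vfield M) : smooth_fun M :=
  metric S (cov_endo D (phi S) X Y) Z.

Definition para_sasaki_like : Prop :=
  forall X Y Z : vfield M, horizontal X -> horizontal Y -> horizontal Z ->
  [/\ fundF X Y Z = 0, fundF (xi S) Y Z = 0, fundF (xi S) (xi S) Z = 0 &
      fundF X Y (xi S) = - metric S X Y].

Definition assoc_metric (X Y : vfield M) : smooth_fun M :=
  metric S X (phi S Y) + eta S X * eta S Y.

Definition paracontact : Prop := forall X Y : vfield M,
  metric S X (phi S Y) *+ 2 = lie_metric (xi S) (metric S) X Y /\
  lie_metric (xi S) (metric S) X Y =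
    cov_form D (eta S) X Y + cov_form D (eta S) Y X.

Definition tensorN (X Y : vfield M) : vfield M :=
  nijenhuis (phi S) X Y - ext_deriv D (eta S) X Y *: xi S.

Definition normal : Prop := forall X Y : vfield M, tensorN X Y = 0.

(* Vector fields whose values at p form an orthonormal basis of the horizontal
   space at p. *)
Definition orthonormal_at (p : M) (e : 'I_(2 * n) -> vfield M) : Prop :=
  is_basis [set x : tangent p | form_at (eta S) p x = 0] (fun i => e i p) /\
  (forall i j, metric S (e i) (e j) p = (i == j)%:R).

(* The values at p of theta(Z) and theta^*(Z). As F is tensorial, they only
   depend on the vectors e_i(p); every orthonormal basis of the horizontal space
   at p is obtained this way, since every tangent vector extends to a global
   vector field. *)
Definition theta (e : 'I_(2 * n) -> vfield M) (Z : vfield M) (p : M) : R :=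
  \sum_i fundF (e i) (e i) Z p.

Definition theta_star (e : 'I_(2 * n) -> vfield M) (Z : vfield M) (p : M) : R :=
  \sum_i fundF (e i) (phi S (e i)) Z p.

End AlmostParacontact.

(* Main.v *)
Require Import Defs.
From mathcomp Require Import all_boot all_order all_algebra.
From mathcomp Require Import all_classical all_reals all_analysis.
From mathcomp Require Import ring.
Import GRing.Theory.
Local Open Scope ring_scope.

(** Write [h X = phi (phi X) = X - eta X *: xi] for the horizontal part of [X].
    The defining conditions of a para-Sasaki-like manifold prescribe
    [F(X, Y, Z) = g((D_X phi) Y, Z)] on horizontal fields and in a few cases
    with [xi] among the arguments. Since [F] is linear over the smooth functions
    in each argument, is symmetric in the last two ([phi] is [g]-symmetric and
    [D] is metric) and satisfies [F(X, xi, xi) = 0], this determines [F]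
    completely ([fundF_para_sasaki]):

      [F(X, Y, Z) = - g(phi X, phi Y) * eta Z - eta Y * g(phi X, phi Z)].

    Every claim is read off from this formula.

    Taking [Y = xi] and using [phi xi = 0], the left-hand side becomes
    [- g(phi (D_X xi), Z)], whence [phi (D_X xi) = phi (phi X)]; as [D_X xi] is
    orthogonal to the unit field [xi], it follows that [D_X xi = phi X]
    ([nabla_xi]). So [D_xi xi = phi xi = 0]; the covariant derivative of [eta]
    is the symmetric form [g(X, phi Y)], which makes [eta] closed; and the Lie
    derivative of [g] along [xi] is twice that form, which is the paracontact
    condition. The Nijenhuis tensor of [phi] is a signed sum of covariant
    derivatives of [phi] ([metric_nijenhuis]) whose terms cancel once the
    formula is inserted; together with [d eta = 0] this gives normality.

    For an orthonormal horizontal frame at a point, [eta] kills the [e_i], so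
    the summand of [theta(Z)] is [- g(e_i, e_i) * eta Z] and that of
    [theta^*(Z)] is [- g(e_i, phi e_i) * eta Z]. The first sum is
    [- 2n * eta Z]. The second is a multiple of the trace of [phi] on the
    horizontal space, which vanishes because the eigenvalues [1] and [-1] have
    the same multiplicity ([trace_phi]). *)

(** * The trace of a projection *)

(** Expanding [b_j] in the [e_i] and applying [P] writes [b_j] as a combination
    of the [b_j'], so by uniqueness the coefficient of [b_j] itself is [1]; the
    [n] coefficients obtained in this way add up to the trace. *)

Lemma trace_projection {R : realType} {V : lmodType R} {k n : nat}
    (H E : set V) (e : 'I_k -> V) (l : 'I_k -> {scalar V}) (b : 'I_n -> V)
    (P : {linear V -> V}) :
  (forall x, H x -> x = \sum_i l i x *: e i) ->
  (forall x, E x -> H x) -> is_basis E b ->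
  (forall i, E (P (e i))) -> (forall x, E x -> P x = x) ->
  \sum_i l i (P (e i)) = n%:R.
Proof.
move=> He EH [Eb bE] EP PE.
have /choice[c Pc] i : exists c : {ffun 'I_n -> R}, P (e i) = \sum_j c j *: b j.
  by have [c [cP _]] := bE _ (EP i); exists c.
have cb j : \sum_i l i (b j) * c i j = 1.
  have [d [_ d_uniq]] := bE _ (Eb j).
  have dE : d = [ffun j' => \sum_i l i (b j) * c i j'].
    apply: d_uniq; rewrite -[LHS]PE // {1}(He _ (EH _ (Eb j))) linear_sum.
    under [RHS]eq_bigr => j' _ do rewrite ffunE scaler_suml.
    rewrite exchange_big; apply: eq_bigr => i _ /=.
    rewrite linearZ /= Pc scaler_sumr.
    by apply: eq_bigr => j' _; rewrite scalerA.
  have dE' : d = [ffun j' => (j' == j)%:R].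
    apply: d_uniq; rewrite (bigD1 j) //= ffunE eqxx scale1r big1 ?addr0 //.
    by move=> j' /negbTE j'j; rewrite ffunE j'j scale0r.
  have := congr1 (fun f : {ffun 'I_n -> R} => f j) dE.
  by rewrite dE' !ffunE eqxx.
under eq_bigr => i _ do rewrite Pc linear_sum /=.
rewrite exchange_big -[n in RHS]card_ord -sum1_card natr_sum /=.
apply: eq_bigr => j _; rewrite -[RHS](cb j); apply: eq_bigr => i _.
by rewrite linearZ /= mulrC.
Qed.

Lemma scaler_half {R : realType} {V : lmodType R} (x : V) :
  2^-1 *: (x + x) = x.
Proof.
by rewrite -mulr2n -(scaler_nat 2 x) scalerA mulVf ?scale1r.
Qed.

(** * Metrics and covariant derivatives *)

Section Linearity.
Context {R : realType} {m : nat} {M : manifold R m}.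

Lemma endo_appD (A : endo_field M) (X Y : vfield M) : A (X + Y) = A X + A Y.
Proof. by apply: vfieldP => p; exact: linearD. Qed.

Lemma endo_appZ (A : endo_field M) f (X : vfield M) : A (f *: X) = f *: A X.
Proof. by apply: vfieldP => p; exact: linearZ. Qed.

Lemma smooth_double_eq0 (f : smooth_fun M) : f + f = 0 -> f = 0.
Proof.
move=> ff; apply: smooth_funP => p.
have /eqP : f p + f p = 0 := congr1 (fun h : smooth_fun M => h p) ff.
by rewrite -mulr2n Num.Theory.mulrn_eq0 => /eqP.
Qed.

Lemma vf_dir1 (X : vfield M) : vf_dir X 1 = 0.
Proof.
have /(congr1 (+%R^~ (- vf_dir X 1))) : vf_dir X 1 = vf_dir X 1 + vf_dir X 1.
  apply: smooth_funP => p; have := tangent_mul (X p) 1 1.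
  by rewrite mulr1 /= !mul1r.
by rewrite addrK subrr.
Qed.

Section Metric.
Variable g : riemannian_metric M.
Implicit Types X Y Z : vfield M.

Lemma metricC X Y : g X Y = g Y X.
Proof. by apply: smooth_funP => p; exact: Defs.metric_sym. Qed.

Lemma metricDl X Y Z : g (X + Y) Z = g X Z + g Y Z.
Proof. by apply: smooth_funP => p; exact: linearDl. Qed.

Lemma metricNl X Z : g (- X) Z = - g X Z.
Proof. by apply: smooth_funP => p; exact: linearNl. Qed.

Lemma metricZl f X Z : g (f *: X) Z = f * g X Z.
Proof. by apply: smooth_funP => p; exact: linearZl_LR. Qed.

Lemma metric_at_eq0 p (x : tangent p) : metric_at g p x x = 0 -> x = 0.
Proof.
move=> gxx; apply/eqP/negP => /negP/(metric_pos g).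
by rewrite gxx Order.POrderTheory.ltxx.
Qed.

Lemma metric_inj X Y : (forall Z, g X Z = g Y Z) -> X = Y.
Proof.
move=> gXY; apply/eqP; rewrite -subr_eq0; apply/eqP/vfieldP => p.
apply: (metric_at_eq0 p); rewrite -[LHS]/(g (X - Y) (X - Y) p).
by rewrite metricDl metricNl gXY subrr.
Qed.

End Metric.

Section CovariantDerivative.
Variables (g : riemannian_metric M) (D : connection M).
Implicit Types (A : endo_field M) (f : smooth_fun M) (X Y Z : vfield M).

Lemma metric_cov_endo A X Y Z :
  g (cov_endo D A X Y) Z = g (D X (A Y)) Z - g (A (D X Y)) Z.
Proof. by rewrite metricDl metricNl. Qed.

(** Pairing with a third field turns the linearity of [(D_X A) Y] into an
    identity in the commutative ring of smooth functions. *)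
Lemma metric_cov_endo_linl A f X X' Y Z :
  g (cov_endo D A (f *: X + X') Y) Z =
  f * g (cov_endo D A X Y) Z + g (cov_endo D A X' Y) Z.
Proof.
rewrite !metric_cov_endo !nabla_tensorial endo_appD endo_appZ.
rewrite !metricDl !metricZl; ring.
Qed.

(** The derivative of the coefficient occurs in [D X (A (f *: Y))] and in
    [A (D X (f *: Y))], and cancels. *)
Lemma metric_cov_endo_linr A f X Y Y' Z :
  g (cov_endo D A X (f *: Y + Y')) Z =
  f * g (cov_endo D A X Y) Z + g (cov_endo D A X Y') Z.
Proof.
rewrite !metric_cov_endo endo_appD endo_appZ !nabla_additive !nabla_leibniz.
rewrite !endo_appD !endo_appZ !metricDl !metricZl; ring.
Qed.

End CovariantDerivative.
End Linearity.

(** * Algebra of almost paracontact structures *)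

Section Structure.
Context {R : realType} {n : nat} {M : manifold R (2 * n + 1)}.
Variable S : almost_paracontact M.
Let g := metric S.

Section Pointwise.
Variable p : M.
Implicit Types x y : tangent p.
Let gp := metric_at g p.
Let ph := endo_at (phi S) p.
Let et := form_at (eta S) p.
Let x0 := xi S p.

(** [phi] maps [xi] to a vector of squared length [1 - 1 * 1]. *)
Lemma phi_at_xi : ph x0 = 0.
Proof.
by apply: (metric_at_eq0 g); rewrite metric_phi metric_xi eta_xi mulr1 subrr.
Qed.

Lemma phi_at_cube x : ph (ph (ph x)) = ph x.
Proof.
rewrite [ph (ph x)]phi_sq linearB linearZ /= -/x0 -/ph.
by rewrite phi_at_xi scaler0 subr0.
Qed.

(** The cube of [phi] equals both [phi] and [phi - (eta \o phi) *: xi]. *)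
Lemma eta_at_phi x : et (ph x) = 0.
Proof.
have /eqP := phi_at_cube x.
rewrite [ph (ph (ph x))]phi_sq -subr_eq0 addrAC subrr add0r oppr_eq0.
by move=> /eqP/(congr1 et); rewrite linearZ linear0 /= [et _]eta_xi mulr1.
Qed.

(** Apply the compatibility of [metric] with [phi] to the horizontal vector
    [ph x]. *)
Lemma phi_at_sym x y : gp (ph x) y = gp x (ph y).
Proof.
have := metric_phi S (ph x) y.
rewrite [form_at _ _ _]eta_at_phi mul0r subr0 => <-.
rewrite phi_sq linearBl linearZl_LR /= -/et -/gp.
rewrite [_ (xi S p) _]Defs.metric_sym metric_xi.
by rewrite [form_at _ _ _]eta_at_phi /= mulr0 subr0.
Qed.

End Pointwise.

Implicit Types X Y Z : vfield M.

Lemma phi_xi : phi S (xi S) = 0.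
Proof. by apply: vfieldP => p; exact: phi_at_xi. Qed.

Lemma eta_phi X : eta S (phi S X) = 0.
Proof. by apply: smooth_funP => p; exact: eta_at_phi. Qed.

Lemma phi_sqr X : phi S (phi S X) = X - eta S X *: xi S.
Proof. by apply: vfieldP => p; exact: phi_sq. Qed.

Lemma phi_cube X : phi S (phi S (phi S X)) = phi S X.
Proof. by apply: vfieldP => p; exact: phi_at_cube. Qed.

Lemma phi_sym X Y : g (phi S X) Y = g X (phi S Y).
Proof. by apply: smooth_funP => p; exact: phi_at_sym. Qed.

Lemma metric_phi_phi X Y : g (phi S X) (phi S Y) = g X Y - eta S X * eta S Y.
Proof. by apply: smooth_funP => p; exact: metric_phi. Qed.

Lemma metric_field_xi X : g X (xi S) = eta S X.
Proof. by apply: smooth_funP => p; exact: metric_xi. Qed.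

Lemma eta_field_xi : eta S (xi S) = 1.
Proof. by apply: smooth_funP => p; exact: eta_xi. Qed.

Lemma horizontal_split X : X = eta S X *: xi S + phi S (phi S X).
Proof. by rewrite phi_sqr addrC subrK. Qed.

(** On the horizontal space, [(1 + phi) / 2] and [(1 - phi) / 2] are projections
    onto the eigenspaces of [1] and [-1]. Both eigenspaces have dimension [n], so
    the traces agree; their difference is the trace of [phi]. *)
Lemma trace_phi p (e : 'I_(2 * n) -> vfield M) : orthonormal_at S p e ->
  \sum_i g (e i) (phi S (e i)) p = 0.
Proof.
move=> [[eH eb] eo].
pose H := [set x : tangent p | form_at (eta S) p x = 0]%classic.
pose l i := metric_at g p (e i p).
(* As the e_i are orthonormal, the coordinates are scalar products. *)
have He x : H x -> x = \sum_i l i x *: e i p.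
  move=> /eb[c [xE _]]; rewrite {1}xE; apply: eq_bigr => i _; congr (_ *: _).
  rewrite xE /l linear_sum (bigD1 i) //= linearZ /=.
  rewrite -[metric_at _ _ _ _]/(g (e i) (e i) p) eo eqxx mulr1.
  rewrite big1 ?addr0 // => j ji; rewrite linearZ /=.
  by rewrite -[metric_at _ _ _ _]/(g (e i) (e j) p) eo eq_sym (negbTE ji) mulr0.
pose ph := endo_at (phi S) p.
pose P : {linear tangent p -> tangent p} := 2^-1 \*: (idfun \+ ph).
pose Q : {linear tangent p -> tangent p} := 2^-1 \*: (idfun \- ph).
have [bP bPE] := phi_eigen1 S p.
have [bQ bQE] := phi_eigenN1 S p.
have phe i : ph (ph (e i p)) = e i p.
  by rewrite [LHS]phi_sq (eH i) scale0r subr0.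
have trP : \sum_i l i (P (e i p)) = n%:R.
  apply: (trace_projection _ _ _ _ _ P He _ bPE) => [x []//|i|x [_ phx]] /=.
    split.
      by rewrite linearZ linearD /= (eH i) [form_at _ _ _]eta_at_phi addr0 mulr0.
    by rewrite linearZ linearD /= -/ph phe addrC.
  by rewrite /ph phx scaler_half.
have trQ : \sum_i l i (Q (e i p)) = n%:R.
  apply: (trace_projection _ _ _ _ _ Q He _ bQE) => [x []//|i|x [_ phx]] /=.
    split.
      by rewrite linearZ linearB /= (eH i) [form_at _ _ _]eta_at_phi subr0 mulr0.
    by rewrite linearZ linearB /= -/ph phe -scalerN opprB.
  by rewrite /ph phx opprK scaler_half.
rewrite -[RHS](subrr (n%:R : R)) -{1}trP -trQ -sumrB; apply: eq_bigr => i _.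
rewrite -linearB /= -scalerBr opprB addrACA [e i p + _]addrC.
by rewrite addrACA subrr addr0 scaler_half.
Qed.

(** * The fundamental tensor *)

Section Connection.
Variable D : connection M.
Hypothesis LC : levi_civita g D.

Let torsion X Y : bracket X Y = D X Y - D Y X.
Proof. by rewrite (proj1 LC). Qed.

Let compat X Y Z : vf_dir X (g Y Z) = g (D X Y) Z + g Y (D X Z).
Proof. exact: (proj2 LC). Qed.

Lemma fundFE X Y Z :
  fundF S D X Y Z = g (D X (phi S Y)) Z - g (D X Y) (phi S Z).
Proof. by rewrite /fundF metric_cov_endo phi_sym. Qed.

(** Differentiate [g (phi Y) Z = g Y (phi Z)] along [X]. *)
Lemma fundF_sym X Y Z : fundF S D X Y Z = fundF S D X Z Y.
Proof.
have := compat X (phi S Y) Z; rewrite phi_sym compat !fundFE.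
rewrite !(metricC g _ Y) (metricC g _ (D X Z)) => /(canRL (addKr _)) ->.
ring.
Qed.

Lemma fundF_linl f X X' Y Z :
  fundF S D (f *: X + X') Y Z = f * fundF S D X Y Z + fundF S D X' Y Z.
Proof. exact: metric_cov_endo_linl. Qed.

Lemma fundF_linm f X Y Y' Z :
  fundF S D X (f *: Y + Y') Z = f * fundF S D X Y Z + fundF S D X Y' Z.
Proof. exact: metric_cov_endo_linr. Qed.

Lemma fundF_linr f X Y Z Z' :
  fundF S D X Y (f *: Z + Z') = f * fundF S D X Y Z + fundF S D X Y Z'.
Proof. by rewrite !(fundF_sym X Y) fundF_linm. Qed.

Lemma nabla0 X : D X 0 = 0.
Proof. by apply: (addrI (D X 0)); rewrite -nabla_additive !addr0. Qed.

(** Differentiate [g xi xi = 1]. *)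
Lemma eta_nabla_xi X : eta S (D X (xi S)) = 0.
Proof.
have := compat X (xi S) (xi S).
rewrite (metricC g (xi S) (D X _)) !metric_field_xi eta_field_xi vf_dir1 => /esym.
exact/smooth_double_eq0.
Qed.

Lemma fundF_xi X Z : fundF S D X (xi S) Z = - g (D X (xi S)) (phi S Z).
Proof.
by rewrite fundFE phi_xi nabla0 -[0](subrr 0) metricDl metricNl subrr sub0r.
Qed.

Lemma fundF_xi_xi X : fundF S D X (xi S) (xi S) = 0.
Proof.
by rewrite fundF_xi phi_xi metricC -[0](subrr 0) metricDl metricNl subrr oppr0.
Qed.

Hypothesis PS : para_sasaki_like S D.

(** Split each argument into its parts along [xi] and in the image of
    [phi \o phi]; the latter is horizontal, so the hypothesis evaluates each of
    the resulting terms. *)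
Lemma fundF_para_sasaki X Y Z :
  fundF S D X Y Z =
  - (g (phi S X) (phi S Y) * eta S Z) - eta S Y * g (phi S X) (phi S Z).
Proof.
have hor W : horizontal S (phi S W) by exact: eta_phi.
rewrite {1}(horizontal_split X) {1}(horizontal_split Y) {1}(horizontal_split Z).
rewrite !(fundF_linl, fundF_linm, fundF_linr) !fundF_xi_xi.
(* In these names, [x] stands for xi and [H] for a horizontal part. *)
have HHH U V W :
    fundF S D (phi S (phi S U)) (phi S (phi S V)) (phi S (phi S W)) = 0.
  by have [] := PS _ _ _ (hor (phi S U)) (hor (phi S V)) (hor (phi S W)).
have xHH U V : fundF S D (xi S) (phi S (phi S U)) (phi S (phi S V)) = 0.
  by have [] := PS _ _ _ (hor (phi S U)) (hor (phi S U)) (hor (phi S V)).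
have xxH U : fundF S D (xi S) (xi S) (phi S (phi S U)) = 0.
  by have [] := PS _ _ _ (hor (phi S U)) (hor (phi S U)) (hor (phi S U)).
have HHx U V : fundF S D (phi S (phi S U)) (phi S (phi S V)) (xi S) =
    - g (phi S U) (phi S V).
  have [_ _ _ ->] := PS _ _ _ (hor (phi S U)) (hor (phi S V)) (hor (phi S V)).
  by rewrite -/g [g (phi S (phi S U)) _]metric_phi_phi !eta_phi mulr0 subr0.
have HxH U V : fundF S D (phi S (phi S U)) (xi S) (phi S (phi S V)) =
    - g (phi S U) (phi S V) by rewrite fundF_sym.
have xHx U : fundF S D (xi S) (phi S (phi S U)) (xi S) = 0 by rewrite fundF_sym.
rewrite !(HHH, xHH, HHx, xxH, HxH, xHx); ring.
Qed.

(** * Consequences for the characteristic field *)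

Lemma nabla_xi X : D X (xi S) = phi S X.
Proof.
apply: (metric_inj g) => Z.
(* Both sides of the claim are orthogonal to xi, so it suffices to compare their
   products with phi (phi Z), which is what testing F(X, xi, _) on phi Z does. *)
have := fundF_xi X (phi S Z).
rewrite fundF_para_sasaki eta_phi phi_xi eta_field_xi mulr0 oppr0 sub0r mul1r.
rewrite metric_phi_phi eta_phi mulr0 subr0 => /oppr_inj gXZ.
by rewrite phi_sym gXZ -phi_sym metric_phi_phi eta_nabla_xi mul0r subr0.
Qed.

Lemma cov_etaE X Y : cov_form D (eta S) X Y = g X (phi S Y).
Proof.
rewrite /cov_form -!metric_field_xi compat nabla_xi addrC addKr metricC.
exact: phi_sym.
Qed.

Lemma ext_deriv_eta X Y : ext_deriv D (eta S) X Y = 0.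
Proof. by rewrite /ext_deriv !cov_etaE -phi_sym metricC subrr. Qed.

Lemma lie_metric_xi X Y : lie_metric (xi S) g X Y = g X (phi S Y) *+ 2.
Proof.
rewrite /lie_metric compat !torsion !nabla_xi (metricC g X (_ - _)).
rewrite !metricDl !metricNl phi_sym (metricC g (D _ Y)) (metricC g _ X); ring.
Qed.

(** Write the brackets as [D X Y - D Y X] and move every outer [phi] to [Z]. *)
Lemma metric_nijenhuis X Y Z :
  g (nijenhuis (phi S) X Y) Z =
  fundF S D (phi S X) Y Z - fundF S D (phi S Y) X Z
  - fundF S D X Y (phi S Z) + fundF S D Y X (phi S Z).
Proof.
rewrite /nijenhuis !torsion !metricDl !metricNl !phi_sym !metricDl !metricNl.
rewrite !fundFE; ring.
Qed.

(** After insertion of the formula for [F], the terms cancel in pairs by the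
    symmetry of [g] and [phi]; since [eta \o phi = 0], those in which [phi] meets
    [eta] are absent from the start. *)
Lemma normal_para_sasaki : normal S D.
Proof.
move=> X Y; apply: (metric_inj g) => Z.
rewrite /tensorN ext_deriv_eta scale0r subr0 metric_nijenhuis.
rewrite !fundF_para_sasaki !eta_phi !phi_sym !phi_cube.
rewrite -(phi_sym Y X) (metricC g (phi S Y)) -[0 in RHS](subrr 0).
rewrite metricDl metricNl; ring.
Qed.

End Connection.
End Structure.

Theorem corollary2p3 (R : realType) (n : nat) (M : manifold R (2 * n + 1))
    (S : almost_paracontact M) (D : connection M) :
  levi_civita (metric S) D ->
  para_sasaki_like S D ->
  (* (a) *)
  ([/\ normal S D /\ paracontact S D,
       (forall X Y : vfield M, horizontal S X -> horizontal S Y ->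
          assoc_metric S X Y *+ 2 = lie_metric (xi S) (metric S) X Y),
       (forall X Y : vfield M, ext_deriv D (eta S) X Y = 0) &
       D (xi S) (xi S) = 0]) /\
  (* (b) *)
  (forall (p : M) (e : 'I_(2 * n) -> vfield M), orthonormal_at S p e ->
     forall Z : vfield M,
       theta S D e Z p = - (2 * n)%:R * eta S Z p /\
       theta_star S D e Z p = 0).
Proof.
move=> LC PS; split.
  split; first split.
  - exact: normal_para_sasaki.
  - move=> X Y; rewrite (lie_metric_xi _ _ LC PS) !(cov_etaE _ _ LC PS).
    split=> //.
    by rewrite -[X in _ + X]phi_sym metricC mulr2n.
  - move=> X Y hX _.
    by rewrite (lie_metric_xi _ _ LC PS) /assoc_metric hX mul0r addr0.
  - exact: ext_deriv_eta LC PS.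
  - by rewrite (nabla_xi _ _ LC PS) phi_xi.
move=> p e oe Z; have [[He _] ge] := oe.
(* The fields e_i are horizontal at p only, so the formula for F at arbitrary
   arguments is what applies to them. *)
have ee i : eta S (e i) p = 0 by exact: He.
have F i W : fundF S D (e i) W Z p =
    - (metric S (phi S (e i)) (phi S W) p * eta S Z p)
    - eta S W p * metric S (phi S (e i)) (phi S Z) p.
  by rewrite (fundF_para_sasaki _ _ LC PS).
split.
  rewrite /theta (eq_bigr (fun=> - eta S Z p)) => [|i _].
    by rewrite sumr_const card_ord mulNrn mulNr mulr_natl.
  rewrite F metric_phi_phi -[(_ - _ : smooth_fun M) p]
    /(metric S (e i) (e i) p - eta S (e i) p * eta S (e i) p).
  by rewrite ge eqxx ee !mul0r !subr0 mul1r.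
rewrite /theta_star.
rewrite (eq_bigr (fun i => - metric S (e i) (phi S (e i)) p * eta S Z p)).
  by rewrite -mulr_suml sumrN trace_phi // oppr0 mul0r.
move=> i _; rewrite F eta_phi mul0r subr0 -mulNr.
by rewrite metric_phi_phi eta_phi mulr0 subr0.
Qed.
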